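(* For the observable queue with uniform intensity $h\equiv\lambda$, the price of anarchy $PoA(\rho,x_0^e,x_1^e,\ldots,x_{n_e-1}^e)$ is unbounded: for every $K>0$ there exist parameters $\lambda,\mu,R,c_w,c_t>0$ with $\frac{R\mu}{c_w}>1$ such that $PoA(\rho,x_0^e,x_1^e,\ldots,x_{n_e-1}^e)>K$.
   Context: Consider an observable first-come first-served M/M/1 queue with service rate $\mu>0$, service value $R>0$, waiting cost $c_w>0$ per unit time in the system, travel cost $c_t>0$ per unit distance (travel is instantaneous), and $R\mu/c_w>1$. For all $x\ge0$, customers at distance less than $x$ from the server arrive according to a Poisson process of rate $\int_0^x h(y)\,dy=\lambda x$, where $h\equiv\lambda>0$. Put $\rho=\lambda/\mu$ and $n_e=\lfloor R\mu/c_w\rfloor$. A customer at distance $x$ observing $i$ customers in the system, $0\le i\le n_e-1$, joins in equilibrium if and only if $x\le x_i^e$, where $$x_i^e=\frac{R\mu-(i+1)c_w}{c_t\mu},\qquad 0\le i\le n_e-1;$$ no customer joins when $n_e$ or more customers are present. If the threshold vector $(x_0,\ldots,x_{n_e-1})\in[0,\infty)^{n_e}$ is used (a customer observing $i$ in the system joins iff his distance is at most $x_i$), the expected social benefit per unit time is $$S(x_0,\ldots,x_{n_e-1})=\frac{\sum_{n=1}^{n_e}\left(x_{n-1}^e-\frac{x_{n-1}}{2}\right)\lambda c_t\,\rho^{n-1}x_0x_1\cdots x_{n-1}}{1+\sum_{n=1}^{n_e}\rho^n x_0x_1\cdots x_{n-1}}.$$ Let $(x_0^*,\ldots,x_{n_e-1}^*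 )$ be a threshold vector maximizing $S$. The price of anarchy is $$PoA(\rho,x_0^e,\ldots,x_{n_e-1}^e)=\frac{S(x_0^*,\ldots,x_{n_e-1}^* )}{S(x_0^e,\ldots,x_{n_e-1}^e)}.$$ *)

(* Defs.v *)
From mathcomp Require Import all_boot all_order all_algebra.
From mathcomp Require Import reals.
Set Implicit Arguments.
Unset Strict Implicit.
Unset Printing Implicit Defensive.
Import Order.TTheory GRing.Theory Num.Theory.
Local Open Scope ring_scope.

(* Parameters: arrival intensity [lambda] per unit distance, service rate [mu],
   service value [V], waiting cost rate [cw], travel cost rate [ct]. *)
Section ObservableQueue.
Context {R : realType}.
Implicit Types lambda mu V cw ct : R.

Definition rho lambda mu : R := lambda / mu.

(* [Num.truncn] agrees with the floor on nonnegative reals. *)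
Definition n_e mu V cw : nat := Num.truncn (V * mu / cw).

Definition x_e mu V cw ct : 'rV[R]_(n_e mu V cw) :=
  \row_(i < n_e mu V cw) ((V * mu - i.+1%:R * cw) / (ct * mu)).

(* Both sums are indexed by i = n - 1, where n ranges over 1, ..., n_e; the
   inner product is x_0 x_1 ... x_i. *)
Definition social_benefit lambda mu V cw ct (x : 'rV[R]_(n_e mu V cw)) : R :=
  (\sum_(i < n_e mu V cw)
     (x_e mu V cw ct 0 i - x 0 i / 2%:R) * (lambda * ct) * rho lambda mu ^+ i
       * \prod_(j < n_e mu V cw | (j <= i)%N) x 0 j)
  / (1 + \sum_(i < n_e mu V cw)
           rho lambda mu ^+ i.+1 * \prod_(j < n_e mu V cw | (j <= i)%N) x 0 j).

Definition threshold_vector (n : nat) (x : 'rV[R]_n) : Prop :=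
  forall i, 0 <= x 0 i.

Definition socially_optimal lambda mu V cw ct (xs : 'rV[R]_(n_e mu V cw)) :
    Prop :=
  threshold_vector xs /\
  forall x : 'rV[R]_(n_e mu V cw), threshold_vector x ->
    social_benefit lambda ct x <= social_benefit lambda ct xs.

(* [v] is the price of anarchy; it does not depend on which optimum is used. *)
Definition is_PoA lambda mu V cw ct (v : R) : Prop :=
  exists2 xs : 'rV[R]_(n_e mu V cw), socially_optimal lambda ct xs &
    v = social_benefit lambda ct xs
        / social_benefit lambda ct (x_e mu V cw ct).

End ObservableQueue.

(* Main.v *)
(* Take mu = cw = ct = 1, V = 2 + e with 0 < e < 1, and rho = lambda = 2 / e^2.
   Then n_e = 2 with equilibrium thresholds 1 + e and e, and the optimum is
   (e, 0), with value 1: for x, y >= 0 the numerator of S / lambda minus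
   e^2 / 2 times its denominator equals
   - (x - e)^2 / 2 - rho x y (1 - e + y / 2) <= 0.
   At equilibrium the server is nearly always in state 2, where the benefit is
   of order e, so the price of anarchy exceeds 1 / e. *)
Require Import Defs.
From mathcomp Require Import all_boot all_order all_algebra.
From mathcomp Require Import reals.
From mathcomp Require Import ring lra.
Import Order.TTheory GRing.Theory Num.Theory.
Local Open Scope ring_scope.

(** The size [n_e] equals 2 only propositionally, being a truncation of a real. Taking [n] as a
    variable and the indices through their values lets [n = 2] be substituted here, so that no row
    vector is ever cast. *)
Lemma sum_ord_eq2 (V : nmodType) (n : nat) (i0 i1 : 'I_n) (F : 'I_n -> V) :
  n = 2%N -> i0 = 0%N :> nat -> i1 = 1%N :> nat -> \sum_i F i = F i0 + F i1.
Proof.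
move=> n2; subst n => v0 v1; rewrite big_ord_recl big_ord1.
by congr (F _ + F _); apply: val_inj.
Qed.

Lemma prod_ord_le0 (A : comPzRingType) (n : nat) (i0 : 'I_n) (F : 'I_n -> A) :
  i0 = 0%N :> nat -> \prod_(j < n | (j <= i0)%N) F j = F i0.
Proof.
move=> v0; rewrite (big_pred1 i0) // => j.
by rewrite v0 leqn0 /= -val_eqE /= v0.
Qed.

Lemma prod_ord_le1 (A : comPzRingType) (n : nat) (i0 i1 : 'I_n)
    (F : 'I_n -> A) :
  i0 = 0%N :> nat -> i1 = 1%N :> nat ->
  \prod_(j < n | (j <= i1)%N) F j = F i0 * F i1.
Proof.
move=> v0 v1; rewrite (bigD1 i0) ?v0 //=; congr (_ * _).
rewrite (big_pred1 i1) // => j; rewrite /= -!val_eqE /= v0 v1.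
by case: (val j) => [|[|]].
Qed.

Lemma n_e_eq2 (R : realType) (mu V cw : R) :
  2%:R <= V * mu / cw < 3%:R -> n_e mu V cw = 2%N.
Proof. exact: truncn_def. Qed.

Lemma social_benefit2 (R : realType) (lambda mu V cw ct : R)
    (x : 'rV[R]_(n_e mu V cw)) (i0 i1 : 'I_(n_e mu V cw)) :
  n_e mu V cw = 2%N -> i0 = 0%N :> nat -> i1 = 1%N :> nat ->
  social_benefit lambda ct x =
    ((x_e mu V cw ct 0 i0 - x 0 i0 / 2%:R) * (lambda * ct) * x 0 i0
     + (x_e mu V cw ct 0 i1 - x 0 i1 / 2%:R) * (lambda * ct)
       * rho lambda mu * (x 0 i0 * x 0 i1))
    / (1 + rho lambda mu * x 0 i0
       + rho lambda mu ^+ 2 * (x 0 i0 * x 0 i1)).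
Proof.
move=> n2 v0 v1; rewrite /social_benefit !(sum_ord_eq2 _ _ _ _ _ n2 v0 v1).
rewrite !(prod_ord_le0 _ _ _ _ v0) !(prod_ord_le1 _ _ _ _ _ v0 v1) v0 v1.
by rewrite expr0 expr1 mulr1 addrA.
Qed.

Section NearCriticalQueue.
Variables (R : realType) (e : R).
Hypotheses (e_gt0 : 0 < e) (e_lt1 : e < 1).

Local Notation N := (n_e 1 (2 + e) 1).
Local Notation S := (@social_benefit R (2 / e ^+ 2) 1 (2 + e) 1 1).
Local Notation xe := (x_e 1 (2 + e) 1 1).

Lemma near_critical_n_e : N = 2%N.
Proof.
move: e_gt0 e_lt1 => e0 e1.
by apply: n_e_eq2; rewrite mulr1 divr1; apply/andP; split; lra.
Qed.

Let N_gt0 : (0 < N)%N. Proof. by rewrite near_critical_n_e. Qed.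
Let N_gt1 : (1 < N)%N. Proof. by rewrite near_critical_n_e. Qed.
Let i0 : 'I_N := Ordinal N_gt0.
Let i1 : 'I_N := Ordinal N_gt1.

Lemma near_critical_x_e : (xe 0 i0 = 1 + e) * (xe 0 i1 = e).
Proof. by split; rewrite mxE /=; field. Qed.

Lemma near_critical_social_benefit (x : 'rV[R]_N) :
  S x = 2 / e ^+ 2 *
    (((1 + e - x 0 i0 / 2) * x 0 i0
       + (e - x 0 i1 / 2) * (2 / e ^+ 2) * (x 0 i0 * x 0 i1))
     / (1 + 2 / e ^+ 2 * x 0 i0 + (2 / e ^+ 2) ^+ 2 * (x 0 i0 * x 0 i1))).
Proof.
rewrite (@social_benefit2 _ _ _ _ _ _ _ i0 i1 near_critical_n_e) //.
rewrite !near_critical_x_e /rho divr1 mulr1 [RHS]mulrA.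
by congr (_ / _); ring.
Qed.

Lemma near_critical_benefit_le1 (x : 'rV[R]_N) : threshold_vector x -> S x <= 1.
Proof.
move: e_gt0 e_lt1 => e0 e1.
move=> x_ge0; rewrite near_critical_social_benefit.
move: (x_ge0 i0) (x_ge0 i1); move: (x 0 i0) (x 0 i1) => a b a_ge0 b_ge0.
have e_neq0 : e != 0 by rewrite gt_eqF.
move rE: (2 / e ^+ 2) => r.
have r_gt0 : 0 < r by rewrite -rE divr_gt0 ?exprn_gt0.
have r_ge0 := ltW r_gt0.
have rab_ge0 : 0 <= r * (a * b) by rewrite !mulr_ge0.
have D_gt0 : 0 < 1 + r * a + r ^+ 2 * (a * b).
  by rewrite -addrA ltr_pwDl // addr_ge0 ?mulr_ge0 ?exprn_ge0.
rewrite [leLHS]mulrA ler_pdivrMr // mul1r -subr_ge0.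
(* The value of [r] enters only through [r * e ^+ 2 / 2 = 1]: this turns the constant 1 into the
   term that completes the square, which is what dictates the arrival rate. The other summand is
   nonnegative because [e < 1]. *)
have -> : 1 + r * a + r ^+ 2 * (a * b)
    - r * ((1 + e - a / 2) * a + (e - b / 2) * r * (a * b))
  = r * ((a - e) ^+ 2 / 2 + r * (a * b) * (1 - e + b / 2)).
  by rewrite -rE; field.
rewrite mulr_ge0 // addr_ge0 ?divr_ge0 ?sqr_ge0 // mulr_ge0 //; lra.
Qed.

(** The equality case of the bound: [e] cancels the square, and the zero threshold, which lets
    nobody join a busy server, cancels the product term. *)
Let x_opt : 'rV[R]_N := \row_i (if i == i0 then e else 0).

Lemma near_critical_benefit_opt : S x_opt = 1.
Proof.
move: e_gt0 e_lt1 => e0 e1.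
rewrite near_critical_social_benefit !mxE /= !mulr0 !addr0.
field; rewrite !gt_eqF //=; lra.
Qed.

Lemma near_critical_socially_optimal : socially_optimal (2 / e ^+ 2) 1 x_opt.
Proof.
split=> [i|x x_ge0]; first by rewrite mxE; case: ifP => // _; exact: ltW.
by rewrite near_critical_benefit_opt near_critical_benefit_le1.
Qed.

(** Numerator and denominator are scaled by [e ^+ 3]. The term [4 * (1 + e)], the weight of state 2,
    then dominates for small [e], and the benefit behaves like [3 * e / 4]. *)
Lemma near_critical_benefit_x_e :
  S xe = e * (3 + e) * (1 + e)
         / (e ^+ 3 + 2 * e * (1 + e) + 4 * (1 + e)).
Proof.
move: e_gt0 e_lt1 => e0 e1.
rewrite near_critical_social_benefit !near_critical_x_e.
have D_gt0 : 0 < e ^+ 3 + 2 * e * (1 + e) + 4 * (1 + e).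
  by rewrite !addr_gt0 ?mulr_gt0 ?exprn_gt0 //; lra.
field; rewrite !gt_eqF //=; nra.
Qed.

Lemma near_critical_PoA :
  is_PoA (2 / e ^+ 2) 1 (2 + e) 1 1 (S xe)^-1.
Proof.
exists x_opt; first exact: near_critical_socially_optimal.
by rewrite near_critical_benefit_opt div1r.
Qed.

Lemma near_critical_PoA_gt : e^-1 < (S xe)^-1.
Proof.
move: e_gt0 e_lt1 => e0 e1.
have D_gt0 : 0 < e ^+ 3 + 2 * e * (1 + e) + 4 * (1 + e).
  by rewrite !addr_gt0 ?mulr_gt0 ?exprn_gt0 //; lra.
rewrite near_critical_benefit_x_e ltf_pV2 ?posrE //; last first.
  by rewrite divr_gt0 // !mulr_gt0 //; lra.
rewrite ltr_pdivrMr // -!mulrA ltr_pM2l //.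
(* After cancelling [e], the right side exceeds the left by [e ^+ 3 + (1 + e) ^+ 2]. *)
have e3_gt0 : 0 < e ^+ 3 by rewrite exprn_gt0.
nra.
Qed.

End NearCriticalQueue.

Theorem theorem4p1 (R : realType) (K : R) (K_gt0 : 0 < K) :
  exists lambda mu V cw ct : R,
    [/\ 0 < lambda, 0 < mu, 0 < V, 0 < cw & 0 < ct] /\
    1 < V * mu / cw /\
    exists PoA : R, is_PoA lambda mu V cw ct PoA /\ K < PoA.
Proof.
have K1_gt0 : 0 < K + 1 by rewrite addr_gt0.
(* This gives [e^-1 = K + 1 > K], while [0 < K] ensures [e < 1]. *)
pose e := (K + 1)^-1.
have e_gt0 : 0 < e by rewrite invr_gt0.
have e_lt1 : e < 1 by rewrite invf_lt1 // ltrDr.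
exists (2 / e ^+ 2), 1, (2 + e), 1, 1; split.
  by split; rewrite ?divr_gt0 ?exprn_gt0 ?addr_gt0.
split; first by rewrite mulr1 divr1; lra.
exists (@social_benefit R (2 / e ^+ 2) 1 (2 + e) 1 1 (x_e 1 (2 + e) 1 1))^-1.
split; first exact: near_critical_PoA.
apply: lt_trans (near_critical_PoA_gt _ _ e_gt0 e_lt1).
by rewrite invrK ltrDl.
Qed.
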